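(* Let $\Omega$ be an infinite compact Hausdorff space and let $X$ be a (real or complex) Banach space such that $X^*$ has the Radon--Nikodym Property. Let $F$ be a nonzero bounded linear functional on $C(\Omega,X)$, identified with an $X^*$-valued regular Borel measure of bounded variation on $\Omega$, let $|F|$ be the total variation of $F$, and let $h:\Omega\to X^*$ be a Borel measurable function with $\|h(\omega)\|=1$ for $|F|$-almost every $\omega$ and $F=h\,d|F|$. Then $F$ attains its norm on $S(C(\Omega,X))$ if and only if there exists $g\in S(C(\Omega,X))$ such that $h(\omega)(g(\omega))=1$ for $|F|$-almost every $\omega\in\Omega$.
   Context: $C(\Omega,X)$ is the Banach space of continuous functions $\Omega\to X$ with the supremum norm, and $S(\cdot)$ denotes the unit sphere of a Banach space. The dual $C(\Omega,X)^*$ is identified isometrically with $M(\Omega,X^* )$, the space of $X^*$-valued regular Borel measures of bounded variation with the total variation norm; under this identification, for $x\in X$ and scalar $f\in C(\Omega)$, with $(x\otimes f)(\omega)=f(\omega)x$, one has $F(x\otimes f)=\int f\,d(x\otimes F)$, where $x\otimes F$ is the scalar measure $(x\otimes F)(A)=F(A)(x)$. The notation $F=h\,d|F|$ means $F(E)=\int_E h\,d|F|$ (Bochner integral) for every Borel set $E\subseteq\Omega$. A functional $F$ attains its norm on $S(C(\Omega,X))$ if there is $f\in S(C(\Omega,X))$ with $F(f)=\|F\|$. *)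

(* Defs.v *)
From HB Require Import structures.
From mathcomp Require Import all_boot all_order all_algebra.
From mathcomp Require Import all_classical all_reals all_analysis.
From mathcomp Require Import complex.

Set Implicit Arguments.
Unset Strict Implicit.
Unset Printing Implicit Defensive.

Import Order.TTheory GRing.Theory Num.Theory.
Import numFieldNormedType.Exports.

Local Open Scope classical_set_scope.
Local Open Scope ring_scope.

Variant scalar_kind := RealScalars | ComplexScalars.

Section scalars.
Context {R : realType}.

Definition scalar_field (k : scalar_kind) : numFieldType :=
  match k with RealScalars => R | ComplexScalars => R[i] end.

Definition sre {k} : scalar_field k -> R :=
  match k return scalar_field k -> R with
  | RealScalars => fun a => a
  | ComplexScalars => fun a => complex.Re a
  end.

Definition sof {k} : R -> scalar_field k :=
  match k return R -> scalar_field k with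
  | RealScalars => fun a => a
  | ComplexScalars => fun a => (a%:C)%C
  end.

Context {k : scalar_kind}.
Local Notation K := (scalar_field k).

Lemma sofK : cancel (@sof k) sre.
Proof. by case: k. Qed.

Lemma sof_inj : injective (@sof k).
Proof. exact: can_inj sofK. Qed.

Lemma sreK (a : K) : 0 <= a -> sof (sre a) = a.
Proof.
case: k a => //= -[a b]; rewrite lecE /= => /andP[/eqP ->] _.
by [].
Qed.

Lemma sof_le : {mono @sof k : a b / a <= b}.
Proof. by case: k => //= a b; rewrite lecR. Qed.

Lemma sofD : {morph @sof k : a b / a + b}.
Proof. by case: k => //= a b; rewrite rmorphD. Qed.

Lemma sofB : {morph @sof k : a b / a - b}.
Proof. by case: k => //= a b; rewrite rmorphB. Qed.

Lemma sofM : {morph @sof k : a b / a * b}.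
Proof. by case: k => //= a b; rewrite rmorphM. Qed.

Lemma sof_eq0 (a : R) : (sof a == 0 :> K) = (a == 0).
Proof. by case: k => //=; rewrite fmorph_eq0. Qed.

Lemma norm_sof (a : R) : `|sof a : K| = sof `|a|.
Proof. by case: k => //=; rewrite normc_def /= expr0n/= addr0 sqrtr_sqr. Qed.

Lemma sof0 : sof 0 = 0 :> K.
Proof. by case: k. Qed.

(* The library's norm of a K-normed module is K-valued; this is the same norm
   read in R. *)
Definition nrm {V : normedModType K} (x : V) : R := sre `|x|.

Section nrm.
Context {V : normedModType K}.
Implicit Types x y : V.

Lemma sof_nrm x : sof (nrm x) = `|x|.
Proof. exact/sreK/normr_ge0. Qed.

Lemma nrm_ge0 x : 0 <= nrm x.
Proof. by rewrite -(@sof_le _) sof_nrm sof0 normr_ge0. Qed.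

Lemma nrmD x y : nrm (x + y) <= nrm x + nrm y.
Proof. by rewrite -(@sof_le _) sofD !sof_nrm ler_normD. Qed.

Lemma nrm0 : nrm (0 : V) = 0.
Proof. by rewrite /nrm normr0 -sof0 sofK. Qed.

Lemma nrm0_eq0 x : nrm x = 0 -> x = 0.
Proof. by move=> x0; apply: normr0_eq0; rewrite -sof_nrm x0 sof0. Qed.

End nrm.

Lemma nrmZ {V : normedModType K} (a : K) (x : V) :
  nrm (a *: x) = nrm (a : K^o) * nrm x.
Proof. by apply: sof_inj; rewrite sofM !sof_nrm normrZ. Qed.

Lemma nrm_sof (a : R) : nrm (sof a : K^o) = `|a|.
Proof. by rewrite /nrm [`|_|]norm_sof sofK. Qed.

Lemma sof_lt : {mono @sof k : a b / a < b}.
Proof. exact: leW_mono sof_le. Qed.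

Lemma nrm_continuous {V : normedModType K} : continuous (nrm : V -> R^o).
Proof.
move=> x; apply/cvgrPdist_lt => e e0; near=> y.
rewrite -sof_lt -norm_sof sofB !sof_nrm.
rewrite (le_lt_trans (ler_dist_dist x y))//.
near: y; apply: cvgr_dist_lt => //.
by rewrite -sof0 sof_lt.
Unshelve. all: by end_near. Qed.

Section supnorm.
Context {T : Type} {V : normedModType K} (A : set T).
Hypothesis A0 : A !=set0.
Implicit Types f g : T -> V.

Definition supnorm f : R := sup [set nrm (f t) | t in A].

Definition bounded_on_set f := exists M : R, forall t, A t -> nrm (f t) <= M.

Lemma le_supnorm f t : bounded_on_set f -> A t -> nrm (f t) <= supnorm f.
Proof.
move=> [M fM] At; apply: ub_le_sup; last by exists t.
by exists M => _ [u Au <-]; exact: fM.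
Qed.

Lemma supnorm_le f M : (forall t, A t -> nrm (f t) <= M) -> supnorm f <= M.
Proof.
move=> fM; apply: ge_sup; first by case: A0 => t At; exists (nrm (f t)), t.
by move=> _ [t At <-]; exact: fM.
Qed.

Lemma supnormD f g : bounded_on_set f -> bounded_on_set g ->
  supnorm (f + g) <= supnorm f + supnorm g.
Proof.
move=> fb gb; apply: supnorm_le => t At.
by rewrite (le_trans (nrmD _ _))// lerD// le_supnorm.
Qed.

Lemma supnorm_ge0 f : bounded_on_set f -> 0 <= supnorm f.
Proof.
by move=> fb; case: A0 => t At; rewrite (le_trans (nrm_ge0 (f t)))// le_supnorm.
Qed.

Let supnormZ_le (a : K) f : bounded_on_set f ->
  supnorm (a *: f) <= nrm (a : K^o) * supnorm f.
Proof.
move=> fb; apply: supnorm_le => t At.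
by rewrite nrmZ ler_wpM2l ?nrm_ge0// le_supnorm.
Qed.

Lemma supnormZ (a : K) f : bounded_on_set f ->
  supnorm (a *: f) = nrm (a : K^o) * supnorm f.
Proof.
move=> fb; apply/eqP; rewrite eq_le supnormZ_le//=.
have afb : bounded_on_set (a *: f).
  case: fb => M fM; exists (nrm (a : K^o) * M) => t At.
  by rewrite nrmZ ler_wpM2l ?nrm_ge0// fM.
have [->|a0] := eqVneq a 0.
  by rewrite (@nrm0 K^o) mul0r scale0r supnorm_ge0//; exists 0 => t _;
    rewrite nrm0.
have na0 : 0 < nrm (a : K^o).
  rewrite lt_def nrm_ge0 andbT; apply: contra a0 => /eqP a0.
  by apply/eqP; exact: (@nrm0_eq0 K^o).
have := supnormZ_le a^-1 afb; rewrite scalerA mulVf// scale1r.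
move=> /(ler_wpM2l (ltW na0)) /le_trans; apply.
rewrite mulrA -(@nrmZ K^o).
by rewrite /GRing.scale/= mulfV// /nrm normr1 -[1]/(1%:R)
  (_ : sre (1 : K) = 1) ?mul1r//; case: (k).
Qed.

Lemma supnorm0_eq0 f : bounded_on_set f -> supnorm f = 0 ->
  forall t, A t -> f t = 0.
Proof.
move=> fb f0 t At; apply: nrm0_eq0; apply/eqP.
by rewrite eq_le nrm_ge0 -f0 le_supnorm.
Qed.
End supnorm.
End scalars.
Arguments scalar_field : clear implicits.

Section dual.
Context {R : realType} {k : scalar_kind} (V : normedModType (scalar_field R k)).
Local Notation K := (scalar_field R k).

Definition bounded_functional (f : V -> K^o) :=
  exists M : R, forall x, nrm (f x) <= M * nrm x.

Definition dual_pred : {pred V -> K^o} :=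
  fun f => `[< linear f /\ bounded_functional f >].

Fact dual_pred_submod : subsemimod_closed dual_pred.
Proof.
apply: GRing.submod_closed_semi; split.
  apply/asboolP; split=> [a x y|]; first by rewrite /= scaler0 addr0.
  by exists 0 => x; rewrite nrm0 mul0r.
move=> a f g /asboolP[lf [M fM]] /asboolP[lg [N gN]]; apply/asboolP; split.
  move=> b x y; rewrite !fctE lf lg !scalerDr !scalerA (mulrC a) -!addrA.
  by congr (_ + _); rewrite addrCA.
exists (nrm (a : K^o) * M + N) => x; rewrite mulrDl (le_trans (nrmD _ _))//.
by rewrite lerD// nrmZ -mulrA ler_wpM2l ?nrm_ge0.
Qed.
HB.instance Definition _ := GRing.isSubmodClosed.Build K (V -> K^o)
  dual_pred dual_pred_submod.

Record dual_space := Dual { dual_fun :> V -> K^o ; _ : dual_fun \in dual_pred }.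

HB.instance Definition _ := [isSub for dual_fun].
HB.instance Definition _ := [Choice of dual_space by <:].
HB.instance Definition _ := [SubChoice_isSubLmodule of dual_space by <:].

Lemma dual_linear (f : dual_space) : linear f.
Proof. by have /asboolP[] := valP f. Qed.

HB.instance Definition _ (f : dual_space) :=
  GRing.isLinear.Build K V K^o _ (dual_fun f) (dual_linear f).

Lemma dual_bounded (f : dual_space) : bounded_functional f.
Proof. by have /asboolP[] := valP f. Qed.

Let ball1 : set V := [set x | nrm x <= 1].

Let ball1_neq0 : ball1 !=set0.
Proof. by exists 0; rewrite /ball1/= nrm0. Qed.

Let dual_bounded_ball (f : dual_space) : bounded_on_set ball1 f.
Proof.
have [M fM] := dual_bounded f; exists (Num.max M 0) => x x1.
rewrite (le_trans (fM x))// (le_trans (y := Num.max M 0 * nrm x))//.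
  by rewrite ler_wpM2r ?nrm_ge0// le_max lexx.
by rewrite ler_piMr// le_max lexx orbT.
Qed.

Definition dual_norm (f : dual_space) : K :=
  sof (supnorm [set x | nrm x <= 1] f).

Let dual_normD f g : dual_norm (f + g) <= dual_norm f + dual_norm g.
Proof. by rewrite -sofD sof_le supnormD. Qed.

Let dual_normZ (a : K) f : dual_norm (a *: f) = `|a| * dual_norm f.
Proof. by rewrite /dual_norm supnormZ// sofM sof_nrm. Qed.

Let dual_norm0_eq0 f : dual_norm f = 0 -> f = 0.
Proof.
rewrite -sof0 => /sof_inj f0.
have fb x : nrm x <= 1 -> f x = 0 by exact: (supnorm0_eq0 _ f0).
apply/val_inj/funext => x /=.
have [->|x0] := eqVneq x 0; first by rewrite linear0.
have /fb : nrm (sof (nrm x)^-1 *: x) <= 1.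
  have nx0 : nrm x != 0 by apply: contra x0 => /eqP/nrm0_eq0/eqP.
  by rewrite nrmZ nrm_sof ger0_norm ?invr_ge0 ?nrm_ge0// mulVf.
rewrite linearZ/= => /eqP; rewrite scaler_eq0 => /orP[|/eqP//].
rewrite sof_eq0 invr_eq0 => /eqP /nrm0_eq0 x00.
by rewrite x00 eqxx in x0.
Qed.

HB.instance Definition _ := Lmodule_isNormed.Build K dual_space
  dual_normD dual_normZ dual_norm0_eq0.
End dual.

Section contfun_pred.
Context {R : realType} {k : scalar_kind} {Omega : ptopologicalType}
  {X : normedModType (scalar_field R k)}.
Local Notation K := (scalar_field R k).

Definition contfun_pred : {pred Omega -> X} := fun f => `[< continuous f >].

Fact contfun_pred_submod : subsemimod_closed contfun_pred.
Proof.
apply: GRing.submod_closed_semi; split.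
  by apply/asboolP => x; exact: cvg_cst.
move=> a f g /asboolP cf /asboolP cg; apply/asboolP => x.
by apply: cvgD; [apply: cvgZl_tmp; exact: cf|exact: cg].
Qed.
HB.instance Definition _ := GRing.isSubmodClosed.Build K (Omega -> X)
  contfun_pred contfun_pred_submod.
End contfun_pred.

(* The compactness proof is a parameter of contfun because it makes the
   supremum norm finite. A point of Omega is required because the measurable
   types of the library are pointed. *)
Record contfun {R : realType} {k : scalar_kind} {Omega : ptopologicalType}
    (cOmega : compact [set: Omega]) (X : normedModType (scalar_field R k)) :=
  ContFun { contfun_fun :> Omega -> X ; _ : contfun_fun \in contfun_pred }.

Section continuous_functions.
Context {R : realType} {k : scalar_kind} {Omega : ptopologicalType}
  (cOmega : compact [set: Omega]) (X : normedModType (scalar_field R k)).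
Local Notation K := (scalar_field R k).
Local Notation C := (contfun cOmega X).

HB.instance Definition _ := [isSub of C for @contfun_fun _ _ _ cOmega X].
HB.instance Definition _ := [Choice of C by <:].
HB.instance Definition _ := [SubChoice_isSubLmodule of C by <:].

Lemma contfun_continuous (f : C) : continuous f.
Proof. by have /asboolP := valP f. Qed.

Let setT_neq0 : [set: Omega] !=set0.
Proof. by exists point. Qed.

Lemma contfun_bounded (f : C) : bounded_on_set setT f.
Proof.
pose g : Omega -> R^o := fun t => nrm (f t).
have cg : continuous g.
  move=> t; apply: (continuous_comp (f := f) (g := nrm : X -> R^o)).
    exact: contfun_continuous.
  exact: nrm_continuous.
have gc : compact (g @` setT).
  by apply: continuous_compact => //; exact: continuous_subspaceT.
have [M [_ /(_ (M + 1))]] := compact_bounded gc.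
rewrite ltrDl ltr01 => /(_ isT) gM.
exists (M + 1) => t _; have := gM (g t).
by rewrite /= ger0_norm ?nrm_ge0//; apply; exists t.
Qed.

Definition contfun_norm (f : C) : K := sof (supnorm setT f).

Let contfun_normD f g : contfun_norm (f + g) <= contfun_norm f + contfun_norm g.
Proof. by rewrite -sofD sof_le supnormD//; exact: contfun_bounded. Qed.

Let contfun_normZ (a : K) f : contfun_norm (a *: f) = `|a| * contfun_norm f.
Proof.
by rewrite /contfun_norm supnormZ ?sofM ?sof_nrm//; exact: contfun_bounded.
Qed.

Let contfun_norm0_eq0 f : contfun_norm f = 0 -> f = 0.
Proof.
rewrite -sof0 => /sof_inj f0.
apply/val_inj/funext => t /=.
by rewrite (supnorm0_eq0 (contfun_bounded f) f0).
Qed.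

HB.instance Definition _ := Lmodule_isNormed.Build K C
  contfun_normD contfun_normZ contfun_norm0_eq0.
End continuous_functions.

Section vector_measures.
Context {R : realType} {k : scalar_kind} {d : measure_display}
  (T : measurableType d) (Y : normedModType (scalar_field R k)).

(* Finite disjoint families of measurable subsets of A give the same supremum
   as finite measurable partitions of A, and the value is nonnegative also when
   A is not measurable, as the library requires of a measure. *)
Definition vector_variation (mu : set T -> Y) (A : set T) : \bar R :=
  ereal_sup [set v | exists n (B : 'I_n -> set T),
    [/\ forall i, measurable (B i), trivIset setT B, forall i, B i `<=` A &
        v = (\sum_(i < n) nrm (mu (B i)))%:E]].

Record bvmeasure := BVMeasure {
  bvmeasure_fun :> set T -> Y ;
  bvmeasure0 : bvmeasure_fun set0 = 0 ;
  bvmeasure_sigma_additive : forall A : (set T)^nat,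
    (forall i, measurable (A i)) -> trivIset setT A ->
    (fun n => \sum_(0 <= i < n) bvmeasure_fun (A i)) @ \oo -->
      bvmeasure_fun (\bigcup_i A i) ;
  bvmeasure_bounded : (vector_variation bvmeasure_fun setT < +oo)%E }.

Definition variation_measure (mu : bvmeasure) : set T -> \bar R :=
  vector_variation mu.

Section variation_measure_theory.
Variable mu : bvmeasure.
Local Notation V := (variation_measure mu).
Local Open Scope ereal_scope.

Let variation_ge0 A : 0 <= V A.
Proof.
apply: ereal_sup_ubound; exists 0%N, (fun=> set0); split.
- by move=> [].
- by apply/trivIsetP => -[].
- by move=> [].
- by rewrite big_ord0.
Qed.

Let variation_set0 : V set0 = 0.
Proof.
apply/eqP; rewrite eq_le variation_ge0 andbT.
apply: ge_ereal_sup => _ [n [B [_ _ B0 ->]]].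
rewrite big1// => i _.
have -> : B i = set0 by rewrite -subset0; exact: B0.
by rewrite bvmeasure0 nrm0.
Qed.

Let le_variation A B : A `<=` B -> V A <= V B.
Proof.
move=> AB; apply: ereal_sup_le => _ [n [C [mC tC CA ->]]].
by exists n, C; split => // i; exact: subset_trans (CA i) AB.
Qed.

Let variationU A B : A `&` B = set0 -> V A + V B <= V (A `|` B).
Proof.
move=> AB0.
have [->|VUfin] := eqVneq (V (A `|` B)) +oo; first by rewrite leey.
have finA : V A \is a fin_num.
  rewrite ge0_fin_numE// (le_lt_trans (le_variation (@subsetUl _ A B)))//.
  by rewrite ltey.
have finU : V (A `|` B) \is a fin_num by rewrite ge0_fin_numE// ltey.
rewrite -leeBrDl//; apply: ge_ereal_sup => _ [n [C [mC tC CB ->]]].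
rewrite leeBrDl// -leeBrDr//; apply: ge_ereal_sup => _ [m [D [mD tD DA ->]]].
rewrite leeBrDr// -EFinD; apply: ereal_sup_ubound.
pose E (i : 'I_(m + n)) :=
  match fintype.split i with inl a => D a | inr b => C b end.
exists (m + n)%N, E; split.
- by move=> i; rewrite /E; case: fintype.split.
- apply/trivIsetP => i j _ _; rewrite /E.
  case: (splitP i) => a ia; case: (splitP j) => b jb ij.
  + move/trivIsetP : tD; apply => //; apply: contra ij => /eqP ab.
    by apply/eqP/val_inj; rewrite /= ia jb ab.
  + by rewrite -subset0 -AB0 => x [/DA ? /CB].
  + by rewrite -subset0 -AB0 => x [/CB ? /DA].
  + move/trivIsetP : tC; apply => //; apply: contra ij => /eqP ab.
    by apply/eqP/val_inj; rewrite /= ia jb ab.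
- move=> i x; rewrite /E; case: fintype.split => a; first by move=> /DA; left.
  by move=> /CB; right.
- rewrite big_split_ord/=; congr (_%:E); congr (_ + _)%R; apply: eq_bigr => i _.
    by rewrite /E (unsplitK (inl _ i)).
  by rewrite /E (unsplitK (inr _ i)).
Qed.

Let nrm_bigcup_le (A : set T) (F : (set T)^nat) : measurable A ->
  (forall i, measurable (F i)) -> trivIset setT F -> A `<=` \bigcup_i F i ->
  (nrm (mu A))%:E <= \sum_(i <oo) (nrm (mu (A `&` F i)))%:E.
Proof.
move=> mA mF tF AF.
have mAF i : measurable (A `&` F i) by exact: measurableI.
have tAF : trivIset setT (fun i => A `&` F i) by exact: trivIset_setIl.
have := @bvmeasure_sigma_additive mu _ mAF tAF.
rewrite -setI_bigcupr (setIidl AF) => cvA.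
have cvr : (fun n => nrm (\sum_(0 <= i < n) mu (A `&` F i))%R) @ \oo -->
    (nrm (mu A) : R^o).
  by apply: (continuous_cvg _ _ cvA); exact: nrm_continuous.
have cvn : (fun n => (nrm (\sum_(0 <= i < n) mu (A `&` F i))%R)%:E) @ \oo -->
    (nrm (mu A))%:E.
  apply: cvg_EFin; first exact: nearW.
  exact: cvr.
rewrite -(cvg_lim _ cvn)//; apply: lime_le.
  by apply/cvg_ex; eexists; exact: cvn.
apply: nearW => n; apply: (le_trans _ (nneseries_lim_ge n _)); last first.
  by move=> i _ _; rewrite lee_fin nrm_ge0.
rewrite sumEFin lee_fin; elim/big_ind2 : _ => //; first by rewrite nrm0.
by move=> x1 x2 y1 y2 h1 h2; rewrite (le_trans (nrmD _ _))// lerD.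
Qed.

Let variation_semi_sigma_additive : semi_sigma_additive V.
Proof.
move=> F mF tF mUF.
suff -> : V (\bigcup_n F n) = \sum_(i <oo) V (F i).
  by apply: is_cvg_nneseries => i _ _; exact: variation_ge0.
apply/eqP; rewrite eq_le; apply/andP; split.
  apply: ge_ereal_sup => _ [n [B [mB tB BF ->]]].
  rewrite -sumEFin.
  apply: (@le_trans _ _
    (\sum_(i < n) \sum_(j <oo) (nrm (mu (B i `&` F j)))%:E)).
    by apply: lee_sum => i _; exact: nrm_bigcup_le.
  rewrite -nneseries_sum; last by move=> *; rewrite lee_fin nrm_ge0.
  apply: lee_nneseries => [i _ _|j _].
    by apply: sume_ge0 => l _; rewrite lee_fin nrm_ge0.
  apply: ereal_sup_ubound; exists n, (fun i => B i `&` F j); split => //.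
  - by move=> i; exact: measurableI.
  - exact: trivIset_setIr.
  - by rewrite sumEFin.
apply: lime_le; first by apply: is_cvg_nneseries => i _ _; exact: variation_ge0.
apply: nearW => n; rewrite big_mkord.
apply: (@le_trans _ _ (V (\big[setU/set0]_(i < n) F i))); last first.
  by apply: le_variation; exact: bigsetU_bigcup.
elim: n => [|n ih]; first by rewrite !big_ord0.
rewrite !big_ord_recr/=; apply: le_trans (variationU _).
  by rewrite leeD2r.
rewrite -subset0 => x [+ Fx]; rewrite -bigcup_mkord => -[i /= ni Fix].
have : i = n by apply: tF => //; exists x.
by move=> ni'; rewrite ni' ltnn in ni.
Qed.

HB.instance Definition _ := isMeasure.Build d T R V
  variation_set0 variation_ge0 variation_semi_sigma_additive.

Let variation_fin_num : fin_num_fun V.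
Proof.
move=> A _; rewrite ge0_fin_numE//.
exact: le_lt_trans (le_variation (@subsetT _ A)) (bvmeasure_bounded mu).
Qed.

HB.instance Definition _ := Measure_isFinite.Build d T R V variation_fin_num.
End variation_measure_theory.
End vector_measures.

Section integrals.
Context {R : realType} {k : scalar_kind} {d : measure_display}
  {T : measurableType d}.
Local Notation K := (scalar_field R k).

Definition simple_function {Y : Type} (s : T -> Y) :=
  finite_set (range s) /\ forall y, measurable (s @^-1` [set y]).

Section bochner.
Context {Y : normedModType K} (m : {finite_measure set T -> \bar R}).

Definition simple_integral (E : set T) (s : T -> Y) : Y :=
  \sum_(y \in range s) sof (fine (m (E `&` s @^-1` [set y]))) *: y.

(* g is Bochner integrable on E with integral y. The function nrm (s n - g) may
   differ from a measurable one on a negligible set; the library integral of a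
   nonnegative function is a supremum over smaller simple functions, so it
   ignores such sets. *)
Definition is_bochner_integral (E : set T) (g : T -> Y) (y : Y) :=
  exists s : (T -> Y)^nat, [/\ forall n, simple_function (s n),
    {ae m, forall t, E t -> (fun n => s n t) @ \oo --> g t},
    (fun n => \int[m]_(t in E) (nrm (s n t - g t))%:E)%E @ \oo --> 0%E &
    (fun n => simple_integral E (s n)) @ \oo --> y].
End bochner.

(* The integral of a bounded measurable function f against a real or complex
   measure nu, as the limit of the integrals of simple functions that converge
   uniformly to f. *)
Definition is_scalar_integral (nu : set T -> K) (f : T -> K^o) (z : K) :=
  exists s : (T -> K^o)^nat, [/\ forall n, simple_function (s n),
    {uniform, s @ \oo --> f} &
    (fun n => \sum_(a \in range (s n)) a * nu (s n @^-1` [set a]) : K^o)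
      @ \oo --> z].
End integrals.

Definition radon_nikodym_property {R : realType} {k : scalar_kind}
    (Y : normedModType (scalar_field R k)) :=
  forall (d : measure_display) (T : measurableType d)
    (m : {finite_measure set T -> \bar R}) (nu : bvmeasure T Y),
  variation_measure nu `<< m ->
  exists g : T -> Y,
    forall E, measurable E -> is_bochner_integral m E g (nu E).

Notation borel Omega := (g_sigma_algebraType (@open Omega)).

Definition regular_measure {R : realType} (Omega : ptopologicalType)
    (m : set (borel Omega) -> \bar R) :=
  forall A : set (borel Omega), measurable A -> forall e : R, 0 < e ->
  exists C U : set Omega,
    [/\ compact C, open U, C `<=` A, A `<=` U & (m (U `\` C) < e%:E)%E].

Section representation.
Context {R : realType} {k : scalar_kind} {Omega : ptopologicalType}
  {cOmega : compact [set: Omega]} {X : normedModType (scalar_field R k)}.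
Local Notation K := (scalar_field R k).

Fact tensor_fun_subproof (x : X) (f : contfun cOmega K^o) :
  (fun t => f t *: x) \in @contfun_pred R k Omega X.
Proof.
by apply/asboolP => t; apply: cvgZr_tmp; exact: contfun_continuous.
Qed.

Definition tensor_fun x f : contfun cOmega X :=
  ContFun _ (tensor_fun_subproof x f).

Definition tensor_measure (x : X) (mu : set (borel Omega) -> dual_space X) :
  set (borel Omega) -> K := fun A => mu A x.

(* F is the functional identified with mu. The functions x (x) f span a dense
   subspace of C(Omega, X), so these equations determine F from mu. *)
Definition represents (mu : bvmeasure (borel Omega) (dual_space X))
    (F : dual_space (contfun cOmega X)) :=
  forall (x : X) (f : contfun cOmega K^o),
    is_scalar_integral (tensor_measure x mu) f (F (tensor_fun x f)).
End representation.

Definition unit_sphere {R : realType} {k : scalar_kind}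
  (V : normedModType (scalar_field R k)) : set V := [set x | `|x| = 1].

Definition attains_norm {R : realType} {k : scalar_kind}
  {V : normedModType (scalar_field R k)} (F : dual_space V) :=
  exists2 f : V, unit_sphere f & F f = `|F|.

(* Main.v *)
Require Import Defs.
From mathcomp Require Import all_boot all_order all_algebra.
From mathcomp Require Import all_classical all_reals all_analysis.
From mathcomp Require Import measurable_realfun ring.

Set Implicit Arguments.
Unset Strict Implicit.
Unset Printing Implicit Defensive.

Import Order.TTheory GRing.Theory Num.Theory.
Import numFieldNormedType.Exports.
Local Open Scope classical_set_scope.
Local Open Scope ring_scope.

(** Write m for the variation of the representing measure and ||.|| for norms. Two
facts carry the proof:

- [Re F g = int Re h(w)(g w) dm(w)] for every g in C(Omega, X)
  ([re_integral_representation]);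
- [||F|| = m(Omega)] ([norm_functional_eq]).

Given these, let ||g|| = 1. Then Re h(g) <= |h(g)| <= 1 almost everywhere, so if
F g = ||F|| then a function bounded above by 1 has integral m(Omega), that is
Re h(g) = 1 almost everywhere; and a scalar of modulus at most 1 with real part 1
is 1. Conversely, if h(g) = 1 almost everywhere then Re F g = ||F||, and
|F g| <= ||F|| forces F g = ||F||. Working with real parts treats both scalar
fields at once and needs only real integrals.

The integral formula holds on tensors: the integral of f against the scalar measure
of x is a limit of integrals of simple functions, and on each level set the Bochner
integral of h, evaluated at a vector, is the integral of the evaluations
([bochner_integral_apply], [tensor_integral]). It extends to all g because finite
sums of tensors are dense ([real_partition_approx]) and both sides are bounded.
This density also gives the measurability of h(g), which is not automatic when X
and its dual are not separable ([measurable_re_pairing]).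

The formula yields ||F|| <= m(Omega) at once. Conversely m(Omega) is a supremum of
sums of ||mu(B i)|| over finite partitions. By regularity each B i is almost filled
by a compact set C i, and Urysohn functions produce a continuous function of norm
at most 1 that is constant on each C i and almost norms mu(B i) there
([separating_function], [partition_sum_le]). *)

(** * Real parts of scalars *)

Section scalars.
Context {R : realType} {k : scalar_kind}.
Local Notation K := (scalar_field R k).
Implicit Types a b : K.

Lemma sreD a b : sre (a + b) = sre a + sre b.
Proof. by case: k a b => //= -[? ?] [? ?]. Qed.

Lemma sre0 : sre (0 : K) = 0.
Proof. by case: k. Qed.

Lemma sof1 : sof 1 = 1 :> K.
Proof. by case: k. Qed.

Lemma sreN a : sre (- a) = - sre a.
Proof. by case: k a => //= -[? ?]. Qed.

Lemma sre_sofM (r : R) a : sre (sof r * a) = r * sre a.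
Proof. by case: k a => //= -[x y] /=; rewrite mul0r subr0. Qed.

Lemma sre_le_nrm a : `|sre a| <= nrm (a : K^o).
Proof.
rewrite /nrm; case: k a => [|[x y]] //=.
by rewrite -sqrtr_sqr ler_wsqrtr// lerDl sqr_ge0.
Qed.

(** The equality case of [Re a <= |a|]: a scalar whose real part exhausts a
bound of its modulus is that bound. It recovers a scalar identity from the real
parts that the integrals below control. *)
Lemma nrm_sre_eq a (r : R) : nrm (a : K^o) <= r -> sre a = r -> a = sof r.
Proof.
rewrite /nrm; case: k a => [|[x y]] //=.
move=> + xr; rewrite xr => xyr.
have r0 : 0 <= r by rewrite (le_trans _ xyr)// sqrtr_ge0.
suff -> : y = 0 by [].
apply/eqP; rewrite -sqrf_eq0 eq_le sqr_ge0 andbT -(lerD2l (r ^+ 2)) addr0.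
by rewrite -ler_sqrt ?sqr_ge0// sqrtr_sqr ger0_norm.
Qed.

(** A unimodular factor (or 0, when a = 0) turns a scalar into its modulus; this
is how a bound on real parts becomes a bound on moduli. *)
Lemma rotate_to_norm a :
  exists2 c : K, nrm (c : K^o) <= 1 & c * a = sof (nrm (a : K^o)).
Proof.
have [->|a0] := eqVneq a 0.
  by exists 0; rewrite ?(@nrm0 _ _ K^o) ?ler01// mulr0 sof0.
have na0 : nrm (a : K^o) != 0.
  by apply: contra a0 => /eqP /(@nrm0_eq0 _ _ K^o) ->.
exists (sof (nrm (a : K^o)) / a); last by rewrite divfK.
rewrite -(@sof_le R k) sof_nrm normrM normfV norm_sof ger0_norm ?nrm_ge0// sof_nrm.
have -> : `|a : K^o| = `|a| by [].
rewrite divff ?normr_eq0//; by case: (k).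
Qed.

Lemma lipschitz_continuous {V W : normedModType K} (f : V -> W) (M : R) :
  (forall x y, nrm (f x - f y) <= M * nrm (x - y)) -> continuous f.
Proof.
move=> fM x; apply/cvgrPdist_lt => e e0.
have e0R : 0 < sre e by rewrite -(@sof_lt R k) sof0 sreK// ltW.
have M1 : 0 < `|M| + 1 by rewrite ltr_wpDl.
near=> y.
rewrite -sof_nrm -(sreK (ltW e0)) sof_lt.
rewrite (le_lt_trans (fM _ _))//.
rewrite (@le_lt_trans _ _ ((`|M| + 1) * nrm (x - y)))//.
  by rewrite ler_wpM2r ?nrm_ge0// (le_trans (ler_norm M))// lerDl.
rewrite mulrC -ltr_pdivlMr// -(@sof_lt R k) sof_nrm.
near: y; apply: cvgr_dist_lt => //.
by rewrite -sof0 sof_lt divr_gt0.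
Unshelve. all: by end_near. Qed.

Lemma sre_continuous : continuous (sre : K^o -> R^o).
Proof.
move=> a; apply/(@cvgrPdist_lt _ R^o _ _ (nbhs_filter (a : K^o))) => e e0.
have e0K : 0 < sof e :> K by rewrite -sof0 sof_lt.
apply: (filterS _ (@cvgr_dist_lt _ K^o _ (nbhs (a : K^o)) _ id a cvg_id _ e0K)).
move=> b; rewrite -sof_nrm sof_lt; apply: le_lt_trans.
by rewrite -sreN -sreD sre_le_nrm.
Qed.

End scalars.

(** * The norm of a dual space *)

Section dual_norm.
Context {R : realType} {k : scalar_kind} {V : normedModType (scalar_field R k)}.
Local Notation K := (scalar_field R k).
Implicit Types (f : dual_space V) (x : V).

Lemma nrm_dual f : nrm f = supnorm [set x | nrm x <= 1] f.
Proof. by rewrite /nrm [`|f|]/(dual_norm f) sofK. Qed.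

Lemma dual_bounded_ball f : bounded_on_set [set x | nrm x <= 1] f.
Proof.
have [M fM] := dual_bounded f; exists `|M| => x x1.
rewrite (le_trans (fM x))// (le_trans (ler_norm _))// normrM.
by rewrite ler_piMr// ger0_norm ?nrm_ge0.
Qed.

Lemma le_dual_norm f x : nrm (f x) <= nrm f * nrm x.
Proof.
have [->|x0] := eqVneq x 0; first by rewrite linear0 !nrm0 mulr0.
have nx : 0 < nrm x.
  by rewrite lt_def nrm_ge0 andbT; apply: contra x0 => /eqP/nrm0_eq0/eqP.
have /(le_supnorm (dual_bounded_ball f)) : nrm (sof (nrm x)^-1 *: x) <= 1.
  by rewrite nrmZ nrm_sof ger0_norm ?invr_ge0 ?nrm_ge0// mulVf ?gt_eqF.
rewrite -nrm_dual linearZ/= nrmZ nrm_sof ger0_norm ?invr_ge0 ?nrm_ge0//.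
by rewrite mulrC ler_pdivrMr.
Qed.

(** The unit ball is stable under unimodular scalars, so the
supremum of |f| on it is that of Re f. *)
Lemma dual_norm_le f (M : R) :
  (forall x, nrm x <= 1 -> sre (f x) <= M) -> nrm f <= M.
Proof.
move=> fM; rewrite nrm_dual; apply: supnorm_le => [|x x1].
  by exists 0; rewrite /= nrm0.
have [c c1 cfx] := rotate_to_norm (f x).
rewrite -(sofK (k := k) (nrm (f x))) -cfx.
have -> : c * f x = f (c *: x) by rewrite linearZ.
apply: fM; rewrite nrmZ (le_trans _ x1)// ler_piMl ?nrm_ge0//.
Qed.

Lemma dual_norming f (e : R) : 0 < e ->
  exists2 x, nrm x <= 1 & nrm f - e < sre (f x).
Proof.
move=> e0; apply: contrapT => H.
suff : nrm f <= nrm f - e by rewrite lerDl oppr_ge0 leNgt e0.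
apply: dual_norm_le => x x1; rewrite leNgt; apply/negP => fx.
by apply: H; exists x.
Qed.

Lemma continuous_apply x : continuous (fun f : dual_space V => f x : K^o).
Proof.
apply: (@lipschitz_continuous _ _ _ K^o _ (nrm x)) => f g.
by rewrite mulrC -[_ - _]/((f - g) x) le_dual_norm.
Qed.

End dual_norm.

(** * Almost everywhere estimates of real integrals *)

Section real_integrals.
Context {R : realType} {d : measure_display} {T : measurableType d}
  (m : {finite_measure set T -> \bar R}).
Implicit Types (E : set T) (phi psi : T -> R).

(** The bound is only required almost everywhere because the density h is only
known to have norm 1 almost everywhere. *)
Lemma ae_bounded_integrable E phi (M : R) : measurable E ->
  measurable_fun setT phi -> {ae m, forall w, `|phi w| <= M} ->
  m.-integrable E (EFin \o phi).
Proof.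
move=> mE mphi phiM.
have mphiE : measurable_fun E (fun w => (phi w)%:E).
  by apply/measurable_EFinP; exact: measurable_funS mphi.
apply/integrableP; split => //.
apply: (@le_lt_trans _ _ (\int[m]_(x in E) (cst `|M|%:E) x)%E).
  apply: ae_ge0_le_integral => //; first exact: measurableT_comp.
    by move=> w _; rewrite lee_fin.
  apply: filterS phiM => w phiw _.
  by rewrite lee_fin (le_trans phiw)// ler_norm.
rewrite integral_cst// lte_mul_pinfty// ?lee_fin//.
by rewrite ltey_eq fin_num_measure.
Qed.

Lemma Rintegral_ae_ge0 E phi : measurable E ->
  m.-integrable E (EFin \o phi) -> {ae m, forall w, E w -> 0 <= phi w} ->
  0 <= \int[m]_(w in E) phi w.
Proof.
move=> mE iphi phi0.
have mphi := measurable_int m iphi.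
have -> : \int[m]_(w in E) phi w = \int[m]_(w in E) `|phi w|.
  congr fine; apply: ae_eq_integral => //.
    by apply/measurable_EFinP/measurableT_comp => //; exact/measurable_EFinP.
  by apply: filterS phi0 => w /[apply] phiw; rewrite ger0_norm.
by apply: Rintegral_ge0 => *.
Qed.

Lemma le_Rintegral_ae E phi psi : measurable E ->
  m.-integrable E (EFin \o phi) -> m.-integrable E (EFin \o psi) ->
  {ae m, forall w, E w -> phi w <= psi w} ->
  \int[m]_(w in E) phi w <= \int[m]_(w in E) psi w.
Proof.
move=> mE iphi ipsi le; rewrite -subr_ge0 -RintegralB//.
apply: Rintegral_ae_ge0 => //.
  exact: (integrableB mE ipsi iphi).
by apply: filterS le => w /[apply]; rewrite subr_ge0.
Qed.

Lemma normr_Rintegral_le_ae E phi psi : measurable E ->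
  m.-integrable E (EFin \o phi) -> m.-integrable E (EFin \o psi) ->
  {ae m, forall w, E w -> `|phi w| <= psi w} ->
  `|\int[m]_(w in E) phi w| <= \int[m]_(w in E) psi w.
Proof.
move=> mE iphi ipsi le; rewrite (le_trans (le_normr_Rintegral _ _))//.
apply: le_Rintegral_ae => //; exact: (integrable_norm iphi).
Qed.

Lemma normr_Rintegral_le_cst E phi (M : R) : measurable E ->
  measurable_fun setT phi -> {ae m, forall w, `|phi w| <= M} ->
  `|\int[m]_(w in E) phi w| <= M * fine (m E).
Proof.
move=> mE mphi phiM; rewrite -Rintegral_cst//.
apply: normr_Rintegral_le_ae => //; first exact: ae_bounded_integrable phiM.
  by apply: (@ae_bounded_integrable _ _ `|M|) => //; exact: aeW.
by apply: filterS phiM.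
Qed.

Lemma Rintegral_bigsetU (I : choiceType) (s : seq I) (B : I -> set T) phi :
  (forall i, measurable (B i)) -> uniq s -> trivIset [set` s] B ->
  m.-integrable (\big[setU/set0]_(i <- s) B i) (EFin \o phi) ->
  \int[m]_(w in \big[setU/set0]_(i <- s) B i) phi w =
  \sum_(i <- s) \int[m]_(w in B i) phi w.
Proof.
move=> mB us tB iphi.
rewrite /Rintegral integral_bigsetU_EFin//; last exact: measurable_int iphi.
rewrite big_seq [RHS]big_seq -sum_fine// => i si.
apply: integrable_fin_num => //; apply: integrableS iphi => //.
  exact: bigsetU_measurable.
by rewrite -bigcup_seq; exact: bigcup_sup.
Qed.

(** A simple function s cuts E into finitely many pieces. Both the simple sums
that define scalar integrals and those that define Bochner integrals are taken
over the range of s, and this is how they meet integrals over E. *)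
Lemma Rintegral_simple_split (Y : choiceType) (s : T -> Y) E phi :
  simple_function s -> measurable E -> m.-integrable E (EFin \o phi) ->
  \int[m]_(w in E) phi w =
  \sum_(y \in range s) \int[m]_(w in E `&` s @^-1` [set y]) phi w.
Proof.
move=> [fs ms] mE iphi.
have UE : E = \bigcup_(y in range s) (E `&` s @^-1` [set y]).
  apply/seteqP; split => [w Ew|w [y _ []//]].
  by exists (s w).
rewrite fsbig_finite//= {1}UE -bigsetU_fset_set//.
rewrite Rintegral_bigsetU ?bigsetU_fset_set -?UE//.
- by move=> y; exact: measurableI.
- exact: trivIset_preimage1_in.
Qed.

Lemma Rintegral_ae_eq0 phi : m.-integrable setT (EFin \o phi) ->
  {ae m, forall w, 0 <= phi w} -> \int[m]_w phi w = 0 ->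
  {ae m, forall w, phi w = 0}.
Proof.
move=> iphi phi0 phi_int0.
have mphi := measurable_int m iphi.
have : (\int[m]_w `|(EFin \o phi) w| = 0)%E.
  rewrite -[RHS]/(0%:E) -phi_int0 fineK; last exact: integrable_fin_num.
  apply: ae_eq_integral => //; first exact: measurableT_comp.
  by apply: filterS phi0 => w phiw _; rewrite /= ger0_norm.
move=> /(ae_eq_integral_abs m measurableT mphi) /=.
by apply: filterS => w /(_ I) [].
Qed.

End real_integrals.

(** * Measurability with values in a non-separable space *)

Section measurability.
Context {R : realType} {d : measure_display} {T : measurableType d}.

(** Stated with the Borel sets of an arbitrary space Z: a sum of two measurable
functions with values in a non-separable normed space may fail to be measurable,
so vector-valued functions are only used through continuous real functions. *)
Lemma measurable_continuous_comp (Z : ptopologicalType) (u : T -> Z)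
    (phi : Z -> R) :
  measurable_fun setT (u : T -> borel Z) -> continuous (phi : Z -> R^o) ->
  measurable_fun setT (fun w => phi (u w)).
Proof.
move=> mu /continuousP cphi.
apply: (measurability _ (RGenOpens.measurableE R)).
move=> _ [_ [a [b ->] <-]].
apply: (mu measurableT (phi @^-1` `]a, b[%classic)).
by apply: sub_sigma_algebra; apply: cphi; exact: interval_open.
Qed.

Lemma simple_bounded (Y : choiceType) (s : T -> Y) (G : Y -> R) :
  simple_function s -> exists M, forall w, `|G (s w)| <= M.
Proof.
move=> [fs _]; exists (\sum_(y \in range s) `|G y|) => w.
rewrite fsbig_finite//= (bigD1_seq (s w))/=; last exact: finmap.fset_uniq.
  by rewrite lerDl sumr_ge0.
by rewrite in_fset_set// inE; exists w.
Qed.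

(** Two arguments are allowed to vary together because one of them takes
finitely many values; this gives the measurability of ||s - h|| for s simple
although subtraction need not be measurable on pairs of functionals. *)
Lemma measurable_simple_comp (Y : choiceType) (s : T -> Y) (G : Y -> T -> R) :
  simple_function s -> (forall y, measurable_fun setT (G y)) ->
  measurable_fun setT (fun w => G (s w) w).
Proof.
move=> [fs ms] mG _ B mB; rewrite setTI.
have -> : (fun w => G (s w) w) @^-1` B =
    \bigcup_(y in range s) (s @^-1` [set y] `&` (G y @^-1` B)).
  apply/seteqP; split => [w Bw|w [y _ [/= <-]]//].
  by exists (s w).
apply: fin_bigcup_measurable => // y _; apply: measurableI => //.
by rewrite -[X in measurable X]setTI; exact: mG.
Qed.

End measurability.

(** * The Bochner integral tested against a vector *)

Section bochner_density.
Context {R : realType} {k : scalar_kind} {d : measure_display}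
  {T : measurableType d} (m : {finite_measure set T -> \bar R})
  {X : normedModType (scalar_field R k)} (h : T -> dual_space X).
Local Notation K := (scalar_field R k).
Hypothesis mh : measurable_fun setT (h : T -> borel (dual_space X)).
Hypothesis h1 : {ae m, forall w, nrm (h w) <= 1}.

Lemma measurable_sre_apply x : measurable_fun setT (fun w => sre (h w x)).
Proof.
apply: (measurable_continuous_comp (phi := fun f : dual_space X => sre (f x)) mh) => f.
apply: (@continuous_comp _ K^o R^o (fun f : dual_space X => f x)).
  exact: continuous_apply.
exact: sre_continuous.
Qed.

Lemma ae_sre_apply_le (g : T -> X) (M : R) : (forall w, nrm (g w) <= M) ->
  {ae m, forall w, `|sre (h w (g w))| <= M}.
Proof.
move=> gM; apply: filterS h1 => w hw.
rewrite (le_trans (sre_le_nrm _))// (le_trans (le_dual_norm _ _))//.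
by rewrite (le_trans _ (gM w))// ler_piMl ?nrm_ge0.
Qed.

Lemma sre_simple_integral E (s : T -> dual_space X) x :
  simple_function s -> measurable E ->
  sre (simple_integral m E s x) = \int[m]_(w in E) sre (s w x).
Proof.
move=> ss mE.
have [M sM] := simple_bounded (fun f : dual_space X => sre (f x)) ss.
rewrite (Rintegral_simple_split ss)//; last first.
  apply: (@ae_bounded_integrable _ _ _ _ _ _ M) => //; last exact: aeW.
  exact: (measurable_simple_comp (G := fun (f : dual_space X) _ => sre (f x))
    ss (fun f => measurable_cst _)).
case: ss => fs ms.
rewrite /simple_integral !fsbig_finite//=.
elim/big_ind2 : _ => [|f1 r1 f2 r2 <- <-|f _].
- exact: sre0.
- by rewrite -sreD.
transitivity (\int[m]_(w in E `&` s @^-1` [set f]) sre (f x)).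
  rewrite Rintegral_cst; last exact: measurableI.
  by rewrite mulrC -sre_sofM.
by apply: eq_Rintegral => w; rewrite inE => -[_ /= ->].
Qed.

(** Let s_n be the approximating simple functions. The real parts of their simple
integrals at x converge to the left side because evaluation at x is continuous
on the dual, and to the right side because Re s_n(x) is within ||x|| ||s_n - h||
of Re h(x). *)
Lemma bochner_integral_apply E y x : measurable E ->
  is_bochner_integral m E h y -> sre (y x) = \int[m]_(w in E) sre (h w x).
Proof.
move=> mE [s [ss _ s0 sy]].
have cy : (fun n => sre (simple_integral m E (s n) x)) @ \oo --> (sre (y x) : R^o).
  apply: (@continuous_cvg _ _ R^o _ _ _ (fun f : dual_space X => sre (f x)) _ _ sy).
  apply: (@continuous_comp _ K^o R^o (fun f : dual_space X => f x)).
    exact: continuous_apply.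
  exact: sre_continuous.
pose D n w := nrm (s n w - h w).
have mD n : measurable_fun setT (D n).
  apply: (measurable_simple_comp (s := s n)
    (G := fun (f : dual_space X) w => nrm (f - h w)) (ss n)) => f.
  apply: (measurable_continuous_comp (Z := dual_space X)
    (phi := fun g : dual_space X => nrm (f - g)) mh) => g.
  apply: (@continuous_comp _ (dual_space X) R^o (fun g => f - g)).
    apply: (@lipschitz_continuous _ _ _ _ _ 1) => g1 g2.
    have -> : f - g1 - (f - g2) = - (g1 - g2).
      by rewrite !opprB addrC addrA subrK.
    by rewrite mul1r /nrm normrN.
  exact: nrm_continuous.
have iD n : m.-integrable E (EFin \o D n).
  have [M sM] := simple_bounded (nrm : dual_space X -> R) (ss n).
  apply: (@ae_bounded_integrable _ _ _ _ _ _ (M + 1)) => //.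
  apply: filterS h1 => w hw; rewrite /D ger0_norm ?nrm_ge0//.
  rewrite (le_trans (nrmD _ _))// lerD//; first exact: le_trans (ler_norm _) (sM w).
  by rewrite /nrm normrN.
have ih : m.-integrable E (EFin \o (fun w => sre (h w x))).
  apply: ae_bounded_integrable => //; first exact: measurable_sre_apply.
  exact: (@ae_sre_apply_le (fun=> x) (nrm x)).
(* The distance to the limit is at most ||x|| + 1 times the integral of D n; the
   summand 1 keeps the divisor of e positive when x = 0. *)
have ch : (fun n => sre (simple_integral m E (s n) x)) @ \oo -->
    (\int[m]_(w in E) sre (h w x) : R^o).
  apply/cvgrPdist_le => e e0.
  have x1 : 0 < nrm x + 1 by rewrite ltr_wpDl ?nrm_ge0.
  have /fine_cvgP[_ /cvgrPdist_le /(_ (e / (nrm x + 1)))] := s0.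
  rewrite divr_gt0// => /(_ isT); apply: filterS => n.
  rewrite sub0r normrN [X in `|X|](_ : _ = \int[m]_(w in E) D n w)//.
  rewrite ler_pdivlMr// => De.
  rewrite distrC sre_simple_integral//.
  have [M sM] := simple_bounded (fun f : dual_space X => sre (f x)) (ss n).
  have isn : m.-integrable E (EFin \o (fun w => sre (s n w x))).
    apply: (@ae_bounded_integrable _ _ _ _ _ _ M) => //; last exact: aeW.
    exact: (measurable_simple_comp
      (G := fun (f : dual_space X) _ => sre (f x)) (ss n)
      (fun f => measurable_cst _)).
  rewrite -RintegralB//.
  apply: (@le_trans _ _ (\int[m]_(w in E) (D n w * (nrm x + 1)))).
    apply: normr_Rintegral_le_ae => //.
    - exact: (integrableB mE isn ih).
    - exact: (integrableZr mE (nrm x + 1) (iD n)).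
    apply: aeW => w _; rewrite -sreN -sreD.
    rewrite (le_trans (sre_le_nrm _))// -[_ - _]/((s n w - h w) x).
    rewrite (le_trans (le_dual_norm _ _))// ler_wpM2l ?nrm_ge0//.
    by rewrite lerDl.
  rewrite RintegralZr//; apply: le_trans De.
  by rewrite ler_wpM2r ?ler_norm// ltW.
exact: (cvg_unique _ cy ch).
Qed.

End bochner_density.

(** * Density of finite tensors in C(Omega, X) *)

Section continuous_functions.
Context {R : realType} {k : scalar_kind} {Omega : ptopologicalType}
  {cOmega : compact [set: Omega]} {X : normedModType (scalar_field R k)}.
Local Notation K := (scalar_field R k).
Implicit Types (f g : contfun cOmega X) (w : Omega).

Lemma nrm_contfun g : nrm g = supnorm setT g.
Proof. by rewrite /nrm [`|g|]/(contfun_norm g) sofK. Qed.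

Lemma le_contfun_norm g w : nrm (g w) <= nrm g.
Proof. by rewrite nrm_contfun le_supnorm//; exact: contfun_bounded. Qed.

Lemma contfun_norm_le g (M : R) : (forall w, nrm (g w) <= M) -> nrm g <= M.
Proof.
by move=> gM; rewrite nrm_contfun; apply: supnorm_le => //; exists point.
Qed.

Lemma contfun_sumE (I : Type) (s : seq I) (G : I -> contfun cOmega X) w :
  (\sum_(i <- s) G i) w = \sum_(i <- s) G i w.
Proof. by elim: s => [|i s ih]; rewrite ?big_nil// !big_cons -ih. Qed.

Lemma sof_continuous : continuous (sof : R^o -> K^o).
Proof.
move=> r; apply/(@cvgrPdist_lt _ K^o _ _ (nbhs_filter (r : R^o))) => e e0.
have e0R : 0 < sre e by rewrite -(@sof_lt R k) sof0 sreK// ltW.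
apply: (filterS _ (@cvgr_dist_lt _ R^o _ (nbhs (r : R^o)) _ id r cvg_id _ e0R)).
by move=> x /= rx; rewrite -sofB norm_sof -(sreK (ltW e0)) sof_lt.
Qed.

Fact real_contfun_subproof (q : Omega -> R) : continuous (q : Omega -> R^o) ->
  (fun w => sof (q w) : K^o) \in @contfun_pred R k Omega K^o.
Proof.
move=> cq; apply/asboolP => w.
by apply: (@continuous_comp _ R^o K^o q); [exact: cq|exact: sof_continuous].
Qed.

Definition real_contfun (q : Omega -> R) (cq : continuous (q : Omega -> R^o)) :
  contfun cOmega K^o := ContFun _ (real_contfun_subproof cq).

(** The functions [max(0, e - ||g - g t||)] are continuous, and by compactness
finitely many of them have a positive sum. Divided by this sum they form a
partition of unity, and where the t-th member does not vanish g is within e of g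
t. The coefficients are real, which makes the pairing with h a finite sum of
products of real functions. *)
Lemma real_partition_approx g (e : R) : 0 < e ->
  exists (s : seq Omega) (q : Omega -> Omega -> R),
    (forall t, continuous (q t : Omega -> R^o)) /\
    forall w, nrm (g w - \sum_(t <- s) sof (q t w) *: g t) <= e.
Proof.
move=> e0.
pose r (t w : Omega) : R := Num.max 0 (e - nrm (g w - g t)).
have cr t : continuous (r t : Omega -> R^o).
  move=> w; apply: (@continuous_max R Omega (fun=> 0) (fun w => e - nrm (g w - g t))).
    exact: cvg_cst.
  apply: (@cvgB _ R^o); first exact: cvg_cst.
  apply: (continuous_comp (f := fun w => g w - g t)); last exact: nrm_continuous.
  by apply: cvgB; [exact: contfun_continuous|exact: cvg_cst].
have r0 t w : 0 <= r t w by rewrite le_max lexx.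
have : cover_compact [set: Omega] by rewrite -compact_cover.
move=> /(_ Omega setT (fun t => r t @^-1` [set y | 0 < y])).
case=> [t _|w _|D _ cD].
- by have /continuousP := cr t; apply; exact: open_gt.
- by exists w => //=; rewrite /r lt_max subrr nrm0 subr0 e0 orbT.
pose S w := \sum_(t <- finmap.enum_fset D) r t w.
have S0 w : 0 < S w.
  have [t /= tD rt] := cD w I.
  rewrite /S (bigD1_seq t) ?finmap.fset_uniq//=.
  by rewrite ltr_pwDl// sumr_ge0.
have cS : continuous (S : Omega -> R^o).
  apply: (@continuous_big R^o Omega +%R 0 xpredT).
    exact: (@pseudometric_normed_Zmodule.add_continuous R R^o).
  by move=> t _; exact: cr.
exists (finmap.enum_fset D), (fun t w => r t w / S w); split => [t w|w].
  apply: (@cvgM R); first exact: cr.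
  apply: (@cvgV R); first by rewrite gt_eqF.
  exact: cS.
have gE : g w = \sum_(t <- finmap.enum_fset D) sof (r t w / S w) *: g w.
  rewrite -scaler_suml -(big_morph _ (@sofD R k) (@sof0 R k)) -mulr_suml.
  rewrite divff; last by rewrite gt_eqF// -/(S w).
  by rewrite sof1 scale1r.
rewrite {1}gE -sumrB.
apply: (@le_trans _ _ (\sum_(t <- finmap.enum_fset D) r t w / S w * e)).
  elim/big_ind2 : _ => [|x1 y1 x2 y2 h1 h2|t _]; first by rewrite nrm0.
    by rewrite (le_trans (nrmD _ _))// lerD.
  rewrite -scalerBr nrmZ nrm_sof ger0_norm ?divr_ge0// ?(ltW (S0 _))//.
  rewrite /r; case: (leP 0 (e - nrm (g w - g t))) => [|_].
    by rewrite subr_ge0 => h; rewrite ler_wpM2l// divr_ge0// ?(ltW (S0 _))// subr_ge0.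
  by rewrite !mul0r.
by rewrite -!mulr_suml divff ?mul1r// gt_eqF// -/(S w).
Qed.

End continuous_functions.

(** * The integral formula for the functional *)

Lemma uniform_cvg_nrm {R : realType} {k : scalar_kind} {T : ptopologicalType}
    (s : nat -> T -> (scalar_field R k)^o) (f : T -> (scalar_field R k)^o) (e : R) :
  0 < e -> {uniform, s @ \oo --> f} ->
  \forall n \near \oo, forall w, nrm (f w - s n w) <= e.
Proof.
move=> e0 sf.
have e0K : 0 < sof e :> scalar_field R k by rewrite -sof0 sof_lt.
have entE := @entourage_ball _ (scalar_field R k)^o (PosNum e0K).
have := @cvg_entourage {uniform` [set: T] -> (scalar_field R k)^o} _ _ f sf
  [set fg | forall t : T, setT t ->
    [set xy : (scalar_field R k)^o * _ | ball xy.1 (sof e) xy.2] (fg.1 t, fg.2 t)].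
rewrite uniform_entourage => /(_ _ _).
move=> H; have {H} [|N _ HN] := H _.
  by exists [set xy : (scalar_field R k)^o * _ | ball xy.1 (sof e) xy.2].
exists N => // n /HN /= snf w; rewrite -(@sof_le R k) sof_nrm ltW//.
exact: snf.
Qed.

Section integral_representation.
Context {R : realType} {k : scalar_kind} {Omega : ptopologicalType}
  {cOmega : compact [set: Omega]} {X : normedModType (scalar_field R k)}.
Local Notation K := (scalar_field R k).
Context (mu : bvmeasure (borel Omega) (dual_space X))
  (h : Omega -> dual_space X).
Local Notation m := (variation_measure mu).
Hypothesis mh :
  measurable_fun [set: borel Omega] (h : borel Omega -> borel (dual_space X)).
Hypothesis h1 : {ae m, forall w, nrm (h w) <= 1}.
Implicit Types (g : contfun cOmega X).

Definition re_pairing (g : Omega -> X) : borel Omega -> R :=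
  fun w => sre (h w (g w)).

Lemma re_pairingD g1 g2 :
  re_pairing (g1 + g2) = (fun w => re_pairing g1 w + re_pairing g2 w).
Proof. by apply/funext => w; rewrite /re_pairing -sreD -linearD. Qed.

Lemma measurable_continuous_borel (q : Omega -> R) :
  continuous (q : Omega -> R^o) ->
  measurable_fun [set: borel Omega] (q : borel Omega -> R).
Proof.
move=> cq; exact: (@measurable_continuous_comp _ _ (borel Omega) Omega id q).
Qed.

(** The map (functional, vector) to value is not measurable for the product of
the Borel sigma-algebras in general. But g is a uniform limit of finite tensors,
whose pairings with h are finite sums of products of measurable real functions,
hence the pairing of g with h is a pointwise limit of these. *)
Lemma measurable_re_pairing g : measurable_fun setT (re_pairing g).
Proof.
have H n : exists G : borel Omega -> R, measurable_fun setT G /\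
    forall w, `|re_pairing g w - G w| <= nrm (h w) * n.+1%:R^-1.
  have [//|s [q [cq gq]]] := @real_partition_approx _ _ _ _ _ g n.+1%:R^-1.
  exists (fun w => \sum_(t <- s) q t w * sre (h w (g t))); split.
    apply: measurable_sum => t; apply: measurable_funM.
      exact: measurable_continuous_borel.
    exact: measurable_sre_apply.
  move=> w.
  have -> : \sum_(t <- s) q t w * sre (h w (g t)) =
      sre (h w (\sum_(t <- s) sof (q t w) *: g t)).
    rewrite linear_sum/= (big_morph _ (@sreD R k) (@sre0 R k)).
    by apply: eq_bigr => t _; rewrite linearZ/= -sre_sofM.
  rewrite /re_pairing -sreN -sreD -linearB.
  rewrite (le_trans (sre_le_nrm _))// (le_trans (le_dual_norm _ _))//.
  by rewrite ler_wpM2l ?nrm_ge0.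
have [G HG] := choice H.
apply: (@measurable_fun_cvg _ _ _ setT G) => [n|w _]; first by have [] := HG n.
apply/cvgrPdist_le => e e0.
have [N _ HN] : \forall n \near \oo, nrm (h w) * n.+1%:R^-1 <= e.
  have : (fun n => nrm (h w) * n.+1%:R^-1 : R^o) @ \oo --> (nrm (h w) * 0 : R^o).
    by apply: cvgMr; exact: cvg_harmonic.
  rewrite mulr0 => /cvgrPdist_le /(_ e e0); apply: filterS => n.
  by rewrite sub0r normrN; apply: le_trans; exact: ler_norm.
exists N => // n /HN; apply: le_trans.
by have [_] := HG n; apply.
Qed.

Lemma integrable_re_pairing (E : set (borel Omega)) g : measurable E ->
  m.-integrable E (EFin \o re_pairing g).
Proof.
move=> mE; apply: ae_bounded_integrable => //; first exact: measurable_re_pairing.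
by apply: (ae_sre_apply_le h1 (M := nrm g)) => w; exact: le_contfun_norm.
Qed.

Lemma normr_integral_re_pairing_le (E : set (borel Omega)) g : measurable E ->
  `|\int[m]_(w in E) re_pairing g w| <= nrm g * fine (m E).
Proof.
move=> mE; apply: normr_Rintegral_le_cst => //; first exact: measurable_re_pairing.
by apply: (ae_sre_apply_le h1 (M := nrm g)) => w; exact: le_contfun_norm.
Qed.

Hypothesis h_density : forall E : set (borel Omega), measurable E ->
  is_bochner_integral m E h (mu E).
Variable F : dual_space (contfun cOmega X).
Hypothesis muF : represents mu F.

(** Along simple s_n converging uniformly to f, the simple sums that define F on
the tensor of x and f have the integrals of Re h(s_n x) as real parts, since h is
the density of mu on each level set of s_n. *)
Lemma tensor_integral x (f : contfun cOmega K^o) :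
  sre (F (tensor_fun x f)) = \int[m]_w re_pairing (tensor_fun x f) w.
Proof.
have [s [ss sf sF]] := muF x f.
set g := tensor_fun x f.
pose phi n (w : borel Omega) := sre (h w (s n w *: x)).
have mphi n : measurable_fun setT (phi n).
  apply: (measurable_simple_comp (s := s n)
    (G := fun (a : K^o) w => sre (h w (a *: x))) (ss n)) => a.
  exact: measurable_sre_apply.
have iphi n : m.-integrable setT (EFin \o phi n).
  have [M sM] := simple_bounded (fun a : K^o => nrm (a *: x)) (ss n).
  apply: (@ae_bounded_integrable _ _ _ _ _ _ M) => //.
  apply: (ae_sre_apply_le h1) => w.
  exact: le_trans (ler_norm _) (sM w).
pose z n : K^o := \sum_(a \in range (s n))
  a * tensor_measure x mu (s n @^-1` [set a]).
have zE n : sre (z n) = \int[m]_w phi n w.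
  rewrite (Rintegral_simple_split (ss n))//.
  case: (ss n) => fs ms.
  rewrite /z !fsbig_finite//= (big_morph _ (@sreD R k) (@sre0 R k)).
  apply: eq_bigr => a _.
  have -> : a * tensor_measure x mu (s n @^-1` [set a]) =
      mu (s n @^-1` [set a]) (a *: x).
    by rewrite linearZ.
  rewrite (bochner_integral_apply mh h1 _ (ms a) (h_density (ms a))) setTI.
  by apply: eq_Rintegral => w; rewrite inE /= => <-.
have cz : (fun n => sre (z n)) @ \oo --> (sre (F g) : R^o).
  by apply: (@continuous_cvg _ K^o R^o _ _ _ _ _ _ sF); exact: sre_continuous.
suff cz' : (fun n => sre (z n)) @ \oo --> (\int[m]_w re_pairing g w : R^o).
  exact: (cvg_unique _ cz cz').
apply/cvgrPdist_le => e e0.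
pose C := nrm x * fine (m setT) + 1.
have C0 : 0 < C by rewrite ltr_wpDl// mulr_ge0 ?nrm_ge0 ?fine_ge0.
have : \forall n \near \oo, forall w, nrm (f w - s n w : K^o) <= e / C.
  by apply: uniform_cvg_nrm sf; rewrite divr_gt0.
apply: filterS => n sn.
rewrite zE -RintegralB//; last exact: integrable_re_pairing.
have gphiE : (fun w => re_pairing g w - phi n w) =
    (fun w => sre (h w ((f w - s n w) *: x))).
  by apply/funext => w; rewrite /re_pairing/phi -sreN -sreD -linearB -scalerBl.
rewrite gphiE.
apply: (@le_trans _ _ ((e / C * nrm x) * fine (m setT))).
  apply: normr_Rintegral_le_cst => //.
    rewrite -gphiE.
    exact: measurable_funB (measurable_re_pairing g) (mphi n).
  apply: (ae_sre_apply_le h1) => w.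
  by rewrite nrmZ ler_wpM2r ?nrm_ge0.
rewrite -mulrA mulrAC ler_pdivrMr// ler_wpM2l ?(ltW e0)//.
by rewrite /C lerDl.
Qed.

(** Both sides are additive in g and bounded by a multiple of its norm, and they
agree on tensors, whose finite sums are dense. *)
Theorem re_integral_representation g :
  sre (F g) = \int[m]_w re_pairing g w.
Proof.
pose P g := sre (F g) = \int[m]_w re_pairing g w.
have P0 : P 0.
  rewrite /P linear0 sre0 (_ : re_pairing 0 = fun=> 0) ?Rintegral_cst ?mul0r//.
  by apply/funext => w; rewrite /re_pairing linear0 sre0.
have PD g1 g2 : P g1 -> P g2 -> P (g1 + g2).
  rewrite /P linearD sreD => -> ->; rewrite re_pairingD RintegralD//;
  exact: integrable_re_pairing.
apply/eqP; rewrite -subr_eq0 -normr_le0; apply/ler_addgt0Pr => e e0.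
rewrite add0r.
pose C := nrm F + fine (m setT) + 1.
have C0 : 0 < C by rewrite ltr_wpDl// addr_ge0 ?nrm_ge0 ?fine_ge0.
have [|s [q [cq gq]]] := @real_partition_approx _ _ _ _ _ g (e / C).
  by rewrite divr_gt0.
pose T : contfun cOmega X := \sum_(t <- s) tensor_fun (g t) (real_contfun (cq t)).
have PT : P T.
  by apply: (big_ind P) => // t _; exact: tensor_integral.
have gT : nrm (g - T) <= e / C.
  apply: contfun_norm_le => w; rewrite (le_trans _ (gq w))// le_eqVlt.
  apply/orP; left; apply/eqP; congr (nrm (g w - _)).
  exact: (contfun_sumE s (fun t => tensor_fun (g t) (real_contfun (cq t)))).
have FE : sre (F g) = sre (F T) + sre (F (g - T)).
  by rewrite -sreD -linearD addrC subrK.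
have gE : re_pairing g = (fun w => re_pairing T w + re_pairing (g - T) w).
  by rewrite -re_pairingD addrC subrK.
rewrite FE PT gE RintegralD//; try exact: integrable_re_pairing.
rewrite opprD addrACA subrr add0r (le_trans (ler_normB _ _))//.
rewrite (@le_trans _ _ (nrm F * (e / C) + (e / C) * fine (m setT)))//.
  apply: lerD.
    rewrite (le_trans (sre_le_nrm _))// (le_trans (le_dual_norm _ _))//.
    by rewrite ler_wpM2l ?nrm_ge0.
  rewrite (le_trans (normr_integral_re_pairing_le _ _))//.
  by rewrite ler_wpM2r ?fine_ge0.
rewrite mulrC -mulrDr mulrAC ler_pdivrMr// ler_wpM2l ?(ltW e0)//.
by rewrite /C lerDl.
Qed.
End integral_representation.

(** * The norm of the functional is the total variation *)

Section norm_of_functional.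
Context {R : realType} {k : scalar_kind} {Omega : ptopologicalType}
  {cOmega : compact [set: Omega]} {X : normedModType (scalar_field R k)}.
Local Notation K := (scalar_field R k).

(** The combination g0 of the x i by Urysohn functions of the C i is right on each
C i but may have norm larger than 1 between them; dividing pointwise by
max(1, ||g0 w||) repairs this and changes nothing on the C i. *)
Lemma separating_function (hOmega : hausdorff_space Omega) n
    (C : 'I_n -> set Omega) (x : 'I_n -> X) :
  (forall i, closed (C i)) -> trivIset setT C -> (forall i, nrm (x i) <= 1) ->
  exists2 g : contfun cOmega X, nrm g <= 1 &
    forall i w, C i w -> g w = x i.
Proof.
move=> clC tC x1.
have H i : exists f : Omega -> R, [/\ continuous (f : Omega -> R^o),
    forall j w, j != i -> C j w -> f w = 0 & forall w, C i w -> f w = 1].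
  have [||||f [cf f0 f1 _]] := @urysohn_ext_itv Omega R
    (compact_normal hOmega cOmega) (\bigcup_(j in [set j | j != i]) C j) (C i) 0 1.
  - by apply: closed_bigcup => [|j _]; [exact: finite_finset|exact: clC].
  - exact: clC.
  - rewrite -subset0 => w [[j /= ji Cjw] Ciw].
    by move/eqP : ji; apply; apply: tC => //; exists w.
  - exact: ltr01.
  exists f; split => // [j w ji Cj|w Ci].
    by apply: f0; exists w => //; exists j.
  by apply: f1; exists w.
have [f Hf] := choice H.
have cf i : continuous (f i : Omega -> R^o) by have [] := Hf i.
pose g0 : contfun cOmega X :=
  \sum_(i <- enum 'I_n) tensor_fun (x i) (real_contfun (cf i)).
have g0C i w : C i w -> g0 w = x i.
  move=> Ciw.
  have -> : g0 w = \sum_(j <- enum 'I_n) sof (f j w) *: x j.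
    exact: (contfun_sumE _ (fun i => tensor_fun (x i) (real_contfun (cf i)))).
  rewrite big_enum/= (bigD1 i)//= big1 => [|j ji].
    have [_ _ ->//] := Hf i; rewrite addr0.
    by rewrite sof1 scale1r.
  have [_ /(_ i w) -> //] := Hf j; first by rewrite sof0 scale0r.
  by rewrite eq_sym.
pose r w : R := (Num.max 1 (nrm (g0 w)))^-1.
have r0 w : 0 < Num.max 1 (nrm (g0 w)) by rewrite lt_max ltr01.
have cr : continuous (r : Omega -> R^o).
  move=> w; apply: (@cvgV R); first by rewrite gt_eqF.
  apply: (@continuous_max R Omega (fun=> 1) (fun w => nrm (g0 w))).
    exact: cvg_cst.
  apply: (continuous_comp (f := g0)); last exact: nrm_continuous.
  exact: contfun_continuous.
have cg : (fun w => sof (r w) *: g0 w) \in @contfun_pred R k Omega X.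
  apply/asboolP => w; apply: cvgZ; last exact: contfun_continuous.
  by apply: (@continuous_comp _ R^o K^o r); [exact: cr|exact: sof_continuous].
exists (ContFun cOmega cg) => [|i w Ciw /=].
  apply: contfun_norm_le => w /=; rewrite nrmZ nrm_sof.
  rewrite gtr0_norm ?invr_gt0// mulrC ler_pdivrMr// mul1r.
  by rewrite le_max lexx orbT.
rewrite /r (g0C i)// (max_idPl (x1 i)) invr1.
by rewrite sof1 scale1r.
Qed.

Context (mu : bvmeasure (borel Omega) (dual_space X))
  (h : Omega -> dual_space X).
Local Notation m := (variation_measure mu).
Hypothesis hOmega : hausdorff_space Omega.
Hypothesis mu_regular : regular_measure (variation_measure mu).
Hypothesis mh :
  measurable_fun [set: borel Omega] (h : borel Omega -> borel (dual_space X)).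
Hypothesis h1 : {ae m, forall w, nrm (h w) <= 1}.
Hypothesis h_density : forall E : set (borel Omega), measurable E ->
  is_bochner_integral m E h (mu E).
Variable F : dual_space (contfun cOmega X).
Hypothesis muF : represents mu F.

Lemma functional_norm_le : nrm F <= fine (m setT).
Proof.
apply: dual_norm_le => g g1; rewrite (le_trans (ler_norm _))//.
rewrite (re_integral_representation mh h1 h_density muF).
rewrite (le_trans (normr_integral_re_pairing_le mh h1 _ _))//.
by rewrite ler_piMl ?fine_ge0.
Qed.

Lemma inner_compact (B : set (borel Omega)) (e : R) : measurable B -> 0 < e ->
  exists C : set (borel Omega), [/\ closed (C : set Omega), measurable C,
    C `<=` B & fine (m (B `\` C)) <= e].
Proof.
move=> mB e0; have [C [U [cC oU CB BU UC]]] := mu_regular mB e0.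
have clC : closed C by exact: compact_closed.
have mC : measurable (C : set (borel Omega)).
  rewrite -(setCK C); apply: measurableC; apply: sub_sigma_algebra.
  exact: closed_openC.
exists C; split => //.
have mU : measurable (U : set (borel Omega)) by exact: sub_sigma_algebra.
rewrite -lee_fin fineK ?fin_num_measure//; last exact: measurableD.
apply: le_trans (ltW UC); apply: le_measure; rewrite ?inE;
  [exact: measurableD|exact: measurableD|].
exact: setSD.
Qed.

(** Choose x i almost norming mu (B i) and a compact C i that fills B i up to a
small mass. A continuous g of norm at most 1 with value x i on C i has Re F g
equal to the sum of the integrals of Re h(g) over the B i. The integral over B i
differs from Re mu (B i) (x i) only through B i minus C i, by at most twice its
mass. *)
Lemma partition_sum_le n (B : 'I_n -> set (borel Omega)) :
  (forall i, measurable (B i)) -> trivIset setT B -> (forall w, exists i, B i w) ->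
  \sum_(i < n) nrm (mu (B i)) <= nrm F.
Proof.
move=> mB tB cB; apply/ler_addgt0Pr => e0 e00.
(* Each piece loses e from the choice of x i and 2 e from B i minus C i. *)
pose e := e0 / (n%:R * 3 + 1).
have n1 : 0 < n%:R * 3 + 1 :> R by rewrite ltr_wpDl.
have ee : 0 < e by rewrite divr_gt0.
have /choice[x Hx] i :
    exists y, nrm y <= 1 /\ nrm (mu (B i)) - e < sre (mu (B i) y).
  by have [y] := dual_norming (mu (B i)) ee; exists y.
have [C HC] := choice (fun i => inner_compact (mB i) ee).
have tC : trivIset setT C.
  apply/trivIsetP => i j _ _ ij; rewrite -subset0 => w [Ci Cj].
  have [_ _ /(_ w Ci) Bi _] := HC i; have [_ _ /(_ w Cj) Bj _] := HC j.
  by move/eqP : ij; apply; apply: tB => //; exists w.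
have [||i|g g1 gC] := @separating_function hOmega n C x.
- by move=> i; have [] := HC i.
- exact: tC.
- by have [] := Hx i.
have ig E := @integrable_re_pairing _ _ _ cOmega _ mu h mh h1 E g.
have split_F : sre (F g) = \sum_(i < n) \int[m]_(w in B i) re_pairing h g w.
  rewrite (re_integral_representation mh h1 h_density muF).
  have UB : [set: borel Omega] = \big[setU/set0]_(i <- enum 'I_n) B i.
    apply/seteqP; split => // w _; rewrite -bigcup_seq.
    have [i Bi] := cB w; exists i => //=.
    by rewrite mem_enum.
  rewrite {1}UB Rintegral_bigsetU ?big_enum//; first exact: enum_uniq.
  - exact: sub_trivIset tB.
  - by rewrite -big_enum/= -UB; exact: ig.
rewrite (@le_trans _ _ (\sum_(i < n) (\int[m]_(w in B i) re_pairing h g w + 3 * e)))//.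
  apply: ler_sum => i _.
  have [x1 /ltW xB] := Hx i; have [clC mC CB BC] := HC i.
  rewrite lerBlDr in xB; rewrite (le_trans xB)//.
  rewrite (bochner_integral_apply mh h1 _ (mB i) (h_density (mB i))).
  have -> : 3 * e = 2 * e + e by ring.
  rewrite addrA lerD2r -lerBlDl.
  have ix E : measurable E -> m.-integrable E (EFin \o (fun w => sre (h w (x i)))).
    move=> mE; apply: ae_bounded_integrable => //; first exact: measurable_sre_apply.
    exact: (ae_sre_apply_le h1 (g := fun=> x i) (M := nrm (x i))).
  rewrite -RintegralB//; [|exact: ix|exact: ig].
  set delta := fun w => _ - _.
  have mBC : measurable (B i `\` C i) by exact: measurableD.
  have BE : B i = C i `|` (B i `\` C i) by rewrite setDUK.
  rewrite BE Rintegral_setU//; last 2 first.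
  - by rewrite -BE; exact: (integrableB (mB i) (ix _ (mB i)) (ig _ (mB i))).
  - by apply/disj_setPS => w [? []].
  have -> : \int[m]_(w in C i) delta w = 0.
    rewrite -[RHS](mul0r (fine (m (C i)))) -(Rintegral_cst m mC).
    apply: eq_Rintegral => w; rewrite inE => Ciw.
    by rewrite /delta /re_pairing (gC i w Ciw) subrr.
  rewrite add0r (le_trans (ler_norm _))//.
  apply: (@le_trans _ _ (2 * fine (m (B i `\` C i)))); last by rewrite ler_wpM2l.
  apply: normr_Rintegral_le_cst => //.
    apply: measurable_funB; first exact: measurable_sre_apply.
    exact: measurable_re_pairing.
  apply: (filterS _ (@ae_sre_apply_le _ _ _ _ m _ h h1 (fun w => x i - g w) 2 _)).
    by move=> w; rewrite linearB sreD sreN.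
  move=> w; rewrite (le_trans (nrmD _ _))//.
  have -> : 2 = 1 + 1 :> R by ring.
  apply: lerD => //; apply: le_trans g1; rewrite {1}/nrm normrN.
  exact: le_contfun_norm.
rewrite big_split/= -split_F sumr_const card_ord.
apply: lerD.
  rewrite (le_trans (ler_norm _))// (le_trans (sre_le_nrm _))//.
  rewrite (le_trans (le_dual_norm _ _))//.
  by rewrite ler_piMr ?nrm_ge0.
rewrite -[leLHS]mulr_natl mulrA /e mulrCA -[leRHS]mulr1 ler_wpM2l ?(ltW e00)//.
by rewrite ler_pdivrMr// mul1r lerDl.
Qed.

(** The variation is a supremum over disjoint families; adding the complement of
the union makes such a family a partition and does not decrease the sum. *)
Theorem norm_functional_eq : nrm F = fine (m setT).
Proof.
apply/eqP; rewrite eq_le functional_norm_le/=.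
rewrite -lee_fin fineK ?fin_num_measure//.
apply: ge_ereal_sup => _ [n [B [mB tB _ ->]]]; rewrite lee_fin.
pose B' (i : 'I_n.+1) :=
  if unlift ord0 i is Some j then B j else ~` \bigcup_j B j.
have B'S j : B' (lift ord0 j) = B j by rewrite /B' liftK.
have B'0 : B' ord0 = ~` \bigcup_j B j by rewrite /B' unlift_none.
apply: (@le_trans _ _ (\sum_(i < n.+1) nrm (mu (B' i)))).
  rewrite big_ord_recl; under [X in _ <= _ + X]eq_bigr do rewrite B'S.
  by rewrite lerDr nrm_ge0.
apply: partition_sum_le => [i||w].
- rewrite /B'; case: unlift => [j|]; first exact: mB.
  by apply/measurableC/fin_bigcup_measurable => //; exact: finite_finset.
- apply/trivIsetP => i j _ _.
  case: (unliftP ord0 i) => [i'|] ->; case: (unliftP ord0 j) => [j'|] ->;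
    rewrite ?eqxx// ?B'S ?B'0 => ij.
  + by move/trivIsetP : tB; apply => //; apply: contra ij => /eqP ->.
  + by rewrite -subset0 => w [Bi]; apply; exists i'.
  + by rewrite -subset0 => w [+ Bj]; apply; exists j'.
- have [[j _ Bj]|nB] := pselect ((\bigcup_j B j) w).
    by exists (lift ord0 j); rewrite B'S.
  by exists ord0; rewrite B'0.
Qed.

End norm_of_functional.

(** * Norm attainment *)

Theorem theorem2p4 (R : realType) (k : scalar_kind)
  (Omega : ptopologicalType) (cOmega : compact [set: Omega])
  (hOmega : hausdorff_space Omega) (iOmega : infinite_set [set: Omega])
  (X : completeNormedModType (scalar_field R k))
  (rnpX : radon_nikodym_property (dual_space X))
  (F : dual_space (contfun cOmega X)) (F0 : F != 0)
  (mu : bvmeasure (borel Omega) (dual_space X))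
  (mu_regular : regular_measure (variation_measure mu))
  (muF : represents mu F)
  (h : Omega -> dual_space X)
  (h_measurable :
    measurable_fun [set: borel Omega] (h : borel Omega -> borel (dual_space X)))
  (h_norm1 : {ae variation_measure mu, forall w, `|h w| = 1})
  (h_density : forall E : set (borel Omega), measurable E ->
    is_bochner_integral (variation_measure mu) E h (mu E)) :
  attains_norm F <->
  exists2 g : contfun cOmega X, unit_sphere g &
    {ae variation_measure mu, forall w, h w (g w) = 1}.
Proof.
have nrm1 (V : normedModType (scalar_field R k)) (v : V) : `|v| = 1 -> nrm v = 1.
  by rewrite /nrm => ->; rewrite -(@sof1 R k) sofK.
have ae_filter := @ae_filter_ringOfSetsType _ _ _ (variation_measure mu).
have h1 : {ae variation_measure mu, forall w, nrm (h w) <= 1}.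
  by apply: filterS h_norm1 => w /nrm1 ->.
have normF := norm_functional_eq hOmega mu_regular h_measurable h1 h_density muF.
have FE := re_integral_representation h_measurable h1 h_density muF.
have ig (g : contfun cOmega X) := integrable_re_pairing h_measurable h1 g measurableT.
have i1 : (variation_measure mu).-integrable setT (EFin \o (fun=> 1)).
  by apply: (@ae_bounded_integrable _ _ _ _ _ _ `|1|) => //; exact: aeW.
have int1 : \int[variation_measure mu]_w 1 = nrm F by rewrite Rintegral_cst// mul1r normF.
split=> [[f /nrm1 f1 Ff]|[g g1 hg]].
  (* Re h(f) <= 1 almost everywhere and its mean is 1. *)
  have intf : \int[variation_measure mu]_w (1 - re_pairing h f w) = 0.
    rewrite (RintegralB measurableT i1 (ig f)) int1.
    by apply/eqP; rewrite subr_eq0 -[X in _ == X]FE Ff.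
  have hf1 : {ae variation_measure mu, forall w,
      nrm (h w (f w) : (scalar_field R k)^o) <= 1}.
    apply: filterS h1 => w hw; rewrite (le_trans (le_dual_norm _ _))//.
    by rewrite mulr_ile1 ?nrm_ge0// -f1 le_contfun_norm.
  exists f; first by rewrite /unit_sphere/= -sof_nrm f1 sof1.
  have re1 : {ae variation_measure mu, forall w, 1 - re_pairing h f w = 0}.
    apply: Rintegral_ae_eq0 intf; first exact: (integrableB measurableT i1 (ig f)).
    apply: filterS hf1 => w hfw; rewrite subr_ge0.
    by rewrite (le_trans (ler_norm _))// (le_trans (sre_le_nrm _)).
  apply: filterS2 hf1 re1 => w hfw /eqP; rewrite subr_eq0 eq_sym => /eqP re1.
  by rewrite -(@sof1 R k); exact: nrm_sre_eq.
exists g => //; rewrite -sof_nrm; apply: nrm_sre_eq.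
  by rewrite (le_trans (le_dual_norm _ _))// (nrm1 _ _ g1) mulr1.
rewrite FE -int1; congr fine; apply: ae_eq_integral => //.
  by apply/measurable_EFinP; exact: measurable_re_pairing.
by apply: filterS hg => w hgw _; rewrite /re_pairing hgw -(@sof1 R k) sofK.
Qed.
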